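(* Let $P$ be a $d$-dimensional polytope with $v$ vertices and $f$ facets, let $S_P$ be its slack matrix, and let $m=\min\{v,f\}$. Then $$\mathrm{rank}^{\mathbb{C}}_{\mathrm{psd}}(S_P)\le m-\left\lfloor\frac{m-1}{d+1}\right\rfloor.$$
   Context: If $P$ is a polytope in $\mathbb{R}^d$ of dimension $d$ with vertices $p_1,\dots,p_v$ and facets cut out by the inequalities $\langle a_1,x\rangle\le b_1,\dots,\langle a_f,x\rangle\le b_f$, its slack matrix $S_P$ is the nonnegative $v\times f$ matrix with $(i,j)$ entry $b_j-\langle a_j,p_i\rangle$. For a nonnegative matrix $A\in\mathbb{R}^{n\times m}$, the complex semidefinite rank $\mathrm{rank}^{\mathbb{C}}_{\mathrm{psd}}(A)$ is the smallest $k$ for which there exist $k\times k$ complex (Hermitian) positive semidefinite matrices $U_1,\dots,U_n,V_1,\dots,V_m$ such that $A_{ij}=\langle U_i,V_j\rangle=\mathrm{tr}(U_iV_j)$ for all $i,j$. (This number for $S_P$ equals the complex semidefinite extension complexity of $P$.) *)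

(* Defs.v *)
From mathcomp Require Import all_boot all_order all_algebra spectral.
From mathcomp Require Import boolp classical_sets reals.
From mathcomp.real_closed Require Import complex.

Set Implicit Arguments.
Unset Strict Implicit.
Unset Printing Implicit Defensive.

Import Order.TTheory GRing.Theory Num.Theory.
Local Open Scope classical_set_scope.
Local Open Scope complex_scope.
Local Open Scope sesquilinear_scope.
Local Open Scope ring_scope.

Definition inner (R : realType) (d : nat) (x y : 'rV[R]_d) : R :=
  \sum_(i < d) x 0 i * y 0 i.

Definition conv_hull (R : realType) (d n : nat) (q : 'I_n -> 'rV[R]_d) :
    set 'rV[R]_d :=
  [set x | exists w : 'I_n -> R,
    [/\ forall i, 0 <= w i, \sum_i w i = 1 & x = \sum_i w i *: q i]].

Definition polytope (R : realType) (d : nat) (P : set 'rV[R]_d) : Prop :=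
  exists (n : nat) (q : 'I_n -> 'rV[R]_d), P = conv_hull q.

Definition affinely_independent (R : realType) (d n : nat)
    (q : 'I_n -> 'rV[R]_d) : Prop :=
  forall c : 'I_n -> R,
    \sum_i c i = 0 -> \sum_i c i *: q i = 0 -> forall i, c i = 0.

(* The affine dimension of [S], i.e., the maximal number of affinely
   independent points of [S], minus one; it is an [int] so that the empty set
   has dimension -1. *)
Definition has_dim (R : realType) (d : nat) (S : set 'rV[R]_d) (k : int) :
    Prop :=
  (exists (n : nat) (q : 'I_n -> 'rV[R]_d),
     [/\ affinely_independent q, forall i, S (q i) & k = n%:Z - 1]) /\
  (forall (n : nat) (q : 'I_n -> 'rV[R]_d),
     affinely_independent q -> (forall i, S (q i)) -> n%:Z - 1 <= k).

Definition valid_ineq (R : realType) (d : nat) (P : set 'rV[R]_d)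
    (a : 'rV[R]_d) (b : R) : Prop :=
  forall x, P x -> inner a x <= b.

(* This is a face of [P] only when [valid_ineq P a b] holds. *)
Definition face_of (R : realType) (d : nat) (P : set 'rV[R]_d)
    (a : 'rV[R]_d) (b : R) : set 'rV[R]_d :=
  P `&` [set x | inner a x = b].

Definition is_face (R : realType) (d : nat) (P F : set 'rV[R]_d) : Prop :=
  exists (a : 'rV[R]_d) (b : R), valid_ineq P a b /\ F = face_of P a b.

Definition is_vertex (R : realType) (d : nat) (P : set 'rV[R]_d)
    (x : 'rV[R]_d) : Prop :=
  is_face P [set x].

(* Facets of a full-dimensional polytope of R^d: the faces of dimension d - 1.
   For d = 0 the only facet of a point is its empty face. *)
Definition is_facet (R : realType) (d : nat) (P F : set 'rV[R]_d) : Prop :=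
  is_face P F /\ has_dim F (d%:Z - 1).

Definition vertices_of (R : realType) (d v : nat) (P : set 'rV[R]_d)
    (p : 'I_v -> 'rV[R]_d) : Prop :=
  injective p /\ range p = [set x | is_vertex P x].

Definition facets_of (R : realType) (d f : nat) (P : set 'rV[R]_d)
    (a : 'I_f -> 'rV[R]_d) (b : 'I_f -> R) : Prop :=
  [/\ forall j, valid_ineq P (a j) (b j),
      injective (fun j => face_of P (a j) (b j)) &
      range (fun j => face_of P (a j) (b j)) = [set F | is_facet P F]].

Definition slack_matrix (R : realType) (d v f : nat) (p : 'I_v -> 'rV[R]_d)
    (a : 'I_f -> 'rV[R]_d) (b : 'I_f -> R) : 'M[R]_(v, f) :=
  \matrix_(i, j) (b j - inner (a j) (p i)).

(* In the order of [R[i]], [0 <= z] means that [z] is real and nonnegative. *)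
Definition psdmx (R : realType) (k : nat) (U : 'M[R[i]]_k) : Prop :=
  U \is hermsymmx /\ forall x : 'rV[R[i]]_k, 0 <= (x *m U *m x ^t*) 0 0.

Definition psd_factorization (R : realType) (n m : nat) (A : 'M[R]_(n, m))
    (k : nat) : Prop :=
  exists (U : 'I_n -> 'M[R[i]]_k) (V : 'I_m -> 'M[R[i]]_k),
    [/\ forall i, psdmx (U i), forall j, psdmx (V j) &
        forall i j, (A i j)%:C = \tr (U i *m V j)].

Lemma psdmx_diag (R : realType) (k : nat) (r : 'I_k -> R) :
  (forall i, 0 <= r i) -> psdmx (diag_mx (\row_i (r i)%:C)).
Proof.
move=> r0; split.
  apply/is_hermitianmxP; rewrite expr0 scale1r; apply/matrixP => i j.
  rewrite !mxE eq_sym; case: eqVneq => [->|_] /=.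
    by rewrite !mulr1n; apply/esym/CrealP/ger0_real; rewrite ler0c.
  by rewrite !mulr0n rmorph0.
move=> x; rewrite mxE; apply: sumr_ge0 => i _.
rewrite mul_mx_diag !mxE mulrAC mulr_ge0 ?mul_conjC_ge0 //.
by rewrite ler0c.
Qed.

Lemma psd_factorization_exists (R : realType) (n m : nat) (A : 'M[R]_(n, m)) :
  (forall i j, 0 <= A i j) -> exists k, `[< psd_factorization A k >].
Proof.
move=> A0; exists m; apply/asboolP.
exists (fun i => diag_mx (\row_j (A i j)%:C)).
exists (fun j => diag_mx (\row_l ((l == j)%:R : R)%:C)); split.
- by move=> i; apply: psdmx_diag.
- by move=> j; apply: psdmx_diag => l; rewrite ler0n.
move=> i j; rewrite mulmx_diag mxtrace_diag (bigD1 j) //= !mxE eqxx mulr1.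
rewrite big1 ?addr0 // => l /negbTE lj.
by rewrite !mxE lj /= mulr0.
Qed.

(* The value 0 in the absence of a factorization is a dummy: it never arises
   for a nonnegative matrix, see [psd_rankC_least]. *)
Definition psd_rankC (R : realType) (n m : nat) (A : 'M[R]_(n, m)) : nat :=
  if pselect (exists k, `[< psd_factorization A k >]) is left h
  then ex_minn h else 0%N.

Lemma psd_rankC_least (R : realType) (n m : nat) (A : 'M[R]_(n, m)) :
  (forall i j, 0 <= A i j) ->
  psd_factorization A (psd_rankC A) /\
  forall k, psd_factorization A k -> (psd_rankC A <= k)%N.
Proof.
move=> A0; rewrite /psd_rankC.
case: pselect => [h|]; last by case; apply: psd_factorization_exists.
case: ex_minnP => k /asboolP Ak kmin; split => // l Al.
exact/kmin/asboolP.
Qed.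

Lemma slack_matrix_ge0 (R : realType) (d v f : nat) (P : set 'rV[R]_d)
    (p : 'I_v -> 'rV[R]_d) (a : 'I_f -> 'rV[R]_d) (b : 'I_f -> R) :
  vertices_of P p -> facets_of P a b ->
  forall i j, 0 <= slack_matrix p a b i j.
Proof.
move=> [_ pP] [abP _ _] i j; rewrite mxE subr_ge0; apply: abP.
have : [set x | is_vertex P x] (p i) by rewrite -pP; exists i.
move=> [a' [b' [_ /seteqP[sub _]]]].
by have [] := sub (p i) erefl.
Qed.

(* Main.v *)
Require Import Defs.
From mathcomp Require Import all_boot all_order all_algebra.
From mathcomp Require Import boolp classical_sets reals.
From mathcomp Require Import spectral ring lra.
From mathcomp.real_closed Require Import complex.

(** The slack matrix has rank at most d + 1, and the bound holds for every
    nonnegative n x m matrix A of rank at most r (with r > 0): its complex psd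
    rank is at most n - (n - 1) %/ r. Applied to the slack matrix or to its
    transpose, whichever has fewer rows, this gives the result.

    A complex matrix B with |B i j|^2 = A i j yields a psd factorization of A
    of size rank B by rank-one matrices: factor B i j = <u_i, w_j> and use the
    projectors onto the lines of u_i and w_j, suitably scaled
    ([psd_factorization_rank]). So the task is to choose the phases of the
    entrywise square root of A so as to create many linear relations between
    the rows.

    Take r + 1 rows of A. They satisfy a relation sum_i c_i A_ij = 0 for all j.
    In column j no number |c_i| A_ij exceeds the sum of the others, and this
    property survives taking square roots. Nonnegative reals with this property
    are the side lengths of a closed polygon in the plane ([polygon_closes]),
    so that phases can be put on the sqrt A_ij to make the relation with
    coefficients sqrt |c_i| hold in each column; rotating the polygon, one may
    moreover prescribe the phase of one row.

    This freedom allows one row i0 to be shared by all relations: the n - 1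
    other rows contain (n - 1) %/ r disjoint groups of r rows, and each group
    together with i0 gives a relation, all of them compatible because row i0
    always receives the phase 1. If row i0 of A is nonzero, every relation
    involves a row of its own group, hence the relations are independent and
    rank B <= n - (n - 1) %/ r ([low_rank_sqrt_phases]). *)

Set Implicit Arguments.
Unset Strict Implicit.
Unset Printing Implicit Defensive.

Import Order.TTheory GRing.Theory Num.Theory.
Local Open Scope complex_scope.
Local Open Scope sesquilinear_scope.
Local Open Scope ring_scope.

(** * Closed polygons with prescribed side lengths *)

Lemma normC_real_sqr (R : rcfType) (z : R[i]) (x : R) :
  0 <= x -> `|z| ^+ 2 = (x ^+ 2)%:C -> `|z| = x%:C.
Proof.
move=> x0 zx; apply: (@pexpIrn _ 2) => //.
- by rewrite nnegrE normr_ge0.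
- by rewrite nnegrE ler0c.
by rewrite zx; exact: rmorphXn.
Qed.

(** Place the third vertex of a triangle on the side c: in the coordinate
    whose unit is c itself, the law of cosines gives its abscissa, and the
    triangle inequalities say that its squared ordinate is nonnegative. *)
Lemma triangle_exists (R : rcfType) (c : R[i]) (r x y : R) :
  0 <= x -> 0 <= y -> `|c| = r%:C -> r <= x + y -> x <= r + y -> y <= r + x ->
  exists z : R[i], `|z| = x%:C /\ `|c - z| = y%:C.
Proof.
move=> x0 y0 cr hr hx hy.
have [c0|cn0] := eqVneq c 0.
  have r0 : r = 0.
    by apply: (@complexI R); rewrite -cr c0 normr0.
  have xy : x = y by lra.
  exists x%:C; rewrite c0 sub0r normrN xy; split;
    by rewrite ger0_norm ?ler0c.
have rgt0 : 0 < r by rewrite -ltcR -cr normr_gt0.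
pose al := (r ^+ 2 + x ^+ 2 - y ^+ 2) / (2 * r ^+ 2).
(* Heron's formula, up to positive factors. *)
have alx : al ^+ 2 <= (x / r) ^+ 2.
  rewrite [leRHS]expr_div_n ler_pdivlMr ?exprn_gt0 // /al.
  rewrite expr_div_n mulrAC ler_pdivrMr; last by rewrite exprn_gt0 // mulr_gt0 // exprn_gt0.
  have -> : x ^+ 2 * (2 * r ^+ 2) ^+ 2 = r ^+ 2 * (2 * r * x) ^+ 2 by ring.
  rewrite mulrC ler_wpM2l ?sqr_ge0 // -subr_ge0.
  have -> : (2 * r * x) ^+ 2 - (r ^+ 2 + x ^+ 2 - y ^+ 2) ^+ 2 =
    ((x + y - r) * (r + y - x)) * ((r + x - y) * (r + x + y)) by ring.
  by rewrite !mulr_ge0 //; lra.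
pose be := Num.sqrt ((x / r) ^+ 2 - al ^+ 2).
have be2 : be ^+ 2 = (x / r) ^+ 2 - al ^+ 2 by rewrite sqr_sqrtr // subr_ge0.
have sqn (s t : R) : `|s +i* t| ^+ 2 = (s ^+ 2 + t ^+ 2)%:C.
  by rewrite -add_Re2_Im2.
exists (c * (al +i* be)); split; apply: normC_real_sqr => //.
  rewrite normrM exprMn cr sqn -rmorphXn -rmorphM /= be2; congr (_%:C).
  by field; rewrite gt_eqF.
have -> : c - c * (al +i* be) = c * ((1 - al) +i* (- be)).
  rewrite -[X in X - _]mulr1 -mulrBr; congr (_ * _).
  by apply/eqP; rewrite eq_complex /= sub0r !eqxx.
rewrite normrM exprMn cr sqn -rmorphXn -rmorphM /= sqrrN be2; congr (_%:C).
by rewrite /al; field; rewrite gt_eqF.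
Qed.

(** By induction on the number of sides: the first side is laid down so that
    the remaining distance to the target is r', and the remaining sides must
    form a polygonal line covering r'. The admissible values of r' form an
    interval, shown to be nonempty by checking that the smaller of its two
    upper bounds lies above all lower bounds. *)
Lemma polygon_target (R : rcfType) (n : nat) (x : 'I_n -> R) (c : R[i]) (r : R) :
  (forall i, 0 <= x i) -> `|c| = r%:C -> r <= \sum_i x i ->
  (forall i, x i *+ 2 <= r + \sum_k x k) ->
  exists z : 'I_n -> R[i], (forall i, `|z i| = (x i)%:C) /\ \sum_i z i = c.
Proof.
elim: n x c r => [|n IHn] x c r x0 cr rle xle.
  exists (fun=> 0); split; first by case.
  rewrite big_ord0; apply/esym/eqP; rewrite -normr_le0 cr lecR.
  by rewrite big_ord0 in rle.
rewrite big_ord_recl in rle.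
set s := \sum_(i < n) x (lift ord0 i) in rle.
have xles i : x i *+ 2 <= r + (x ord0 + s) by rewrite -big_ord_recl.
have r0 : 0 <= r by rewrite -ler0c -cr.
have s0 : 0 <= s by apply: sumr_ge0.
have xs i : x (lift ord0 i) <= s.
  by rewrite /s (bigD1 i) //= lerDl sumr_ge0.
have x00 := x0 ord0; have xl0 := xles ord0.
pose r' := Num.min (r + x ord0) s.
have [r'D r's] : r' <= r + x ord0 /\ r' <= s by rewrite !ge_min !lexx orbT.
have r'0 : 0 <= r' by rewrite le_min s0 addr_ge0.
have r'_ge u : u <= r + x ord0 -> u <= s -> u <= r' by rewrite le_min => -> ->.
have [z0 [z0x z0c]] : exists z : R[i], `|z| = (x ord0)%:C /\ `|c - z| = r'%:C.
  apply: (triangle_exists x00 r'0 cr) => //.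
    by rewrite -lerBlDl; apply: r'_ge; lra.
  by rewrite -lerBlDl; apply: r'_ge; lra.
have [|//||z [zx zc]] := IHn (fun i => x (lift ord0 i)) _ _ _ z0c.
- by move=> i; apply: x0.
- move=> i; rewrite -/s -lerBlDr; apply: r'_ge.
    by have := xles (lift ord0 i); lra.
  by have := xs i; lra.
exists (fun i => if unlift ord0 i is Some k then z k else z0); split.
  by move=> i; case: unliftP => [k|] ->.
rewrite big_ord_recl unlift_none; under eq_bigr do rewrite liftK.
by rewrite zc addrC subrK.
Qed.

(** The closed polygon is encoded by the unit directions of its sides rather
    than by the sides, so that sides of length zero also get a direction: the
    lengths will be products, one factor of which may vanish while the other
    one still needs a phase. *)
Lemma polygon_closes (R : rcfType) (n : nat) (x : 'I_n -> R) (i0 : 'I_n) :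
  (forall i, 0 <= x i) -> (forall i, x i *+ 2 <= \sum_k x k) ->
  exists u : 'I_n -> R[i],
    [/\ forall i, `|u i| = 1, u i0 = 1 & \sum_i (x i)%:C * u i = 0].
Proof.
move=> x0 xle.
have [|||z [zx z0]] := @polygon_target R n x 0 0 x0.
- by rewrite normr0.
- exact: sumr_ge0.
- by move=> i; rewrite add0r.
pose w i := if x i == 0 then 1 else z i / (x i)%:C.
have w1 i : `|w i| = 1.
  rewrite /w; case: eqVneq => [_|xi]; first exact: normr1.
  by rewrite normf_div zx ger0_norm ?ler0c // divff // (inj_eq (@complexI R)).
have wz i : (x i)%:C * w i = z i.
  rewrite /w; case: eqVneq => [xi|xi]; last first.
    by rewrite mulrC divfK // (inj_eq (@complexI R)).
  by apply/esym/eqP; rewrite xi mul0r -normr_eq0 zx xi.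
have wn0 : w i0 != 0 by rewrite -normr_eq0 w1 oner_eq0.
exists (fun i => w i / w i0); split.
- by move=> i; rewrite normf_div !w1 divr1.
- by rewrite divff.
by under eq_bigr do rewrite mulrA wz; rewrite -mulr_suml z0 mul0r.
Qed.

(** * Phases turning a real dependence into one between square roots *)

(** Writing x_k for sqrt |c_k s_k|, the relation bounds x_i^2 by the sum of the
    other x_k^2, which is at most the square of the sum of the other x_k. *)
Lemma sqrt_dependence_le (R : rcfType) (n : nat) (c s : 'I_n -> R) :
  (forall i, 0 <= s i) -> \sum_i c i * s i = 0 ->
  forall i, (Num.sqrt `|c i| * Num.sqrt (s i)) *+ 2 <=
            \sum_k Num.sqrt `|c k| * Num.sqrt (s k).
Proof.
move=> s0 cs0 i.
pose x k := Num.sqrt `|c k| * Num.sqrt (s k).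
have x0 k : 0 <= x k by apply: mulr_ge0; apply: sqrtr_ge0.
have x2 k : x k ^+ 2 = `|c k * s k|.
  by rewrite exprMn !sqr_sqrtr // normrM (ger0_norm (s0 k)).
rewrite (bigD1 i) //= mulr2n lerD2l -/(x i).
set t := \sum_(k < n | k != i) _.
have t0 : 0 <= t by apply: sumr_ge0 => k _; apply: x0.
rewrite -(@ler_pXn2r _ 2) ?nnegrE // x2.
move: cs0; rewrite (bigD1 i) //= => /eqP; rewrite addr_eq0 => /eqP ->.
rewrite normrN; apply: (le_trans (ler_norm_sum _ _ _)).
rewrite expr2 {1}/t mulr_suml; apply: ler_sum => k ki.
rewrite -x2 expr2; apply: (ler_wpM2l (x0 k)).
by rewrite /t (bigD1 k) //= lerDl; apply: sumr_ge0 => l _; apply: x0.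
Qed.

Lemma sqrt_phases_dependent (R : rcfType) (n : nat) (c s : 'I_n -> R)
    (i0 : 'I_n) :
  (forall i, 0 <= s i) -> \sum_i c i * s i = 0 ->
  exists z : 'I_n -> R[i],
    [/\ forall i, `|z i| = (Num.sqrt (s i))%:C, z i0 = (Num.sqrt (s i0))%:C &
        \sum_i (Num.sqrt `|c i|)%:C * z i = 0].
Proof.
move=> s0 cs0.
have x0 i : 0 <= Num.sqrt `|c i| * Num.sqrt (s i).
  by apply: mulr_ge0; apply: sqrtr_ge0.
have [u [u1 ui0 u0]] := polygon_closes i0 x0 (sqrt_dependence_le s0 cs0).
exists (fun i => (Num.sqrt (s i))%:C * u i); split.
- by move=> i; rewrite normrM u1 mulr1 ger0_norm // ler0c sqrtr_ge0.
- by rewrite ui0 mulr1.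
by rewrite -[RHS]u0; apply: eq_bigr => i _; rewrite mulrA rmorphM.
Qed.

(** * Many independent relations between the rows *)

Lemma dependent_rows (F : fieldType) (n m : nat) (A : 'M[F]_(n, m))
    (S : {set 'I_n}) :
  (\rank A < #|S|)%N ->
  exists c : 'rV[F]_n,
    [/\ c != 0, c *m A = 0 & forall i, i \notin S -> c 0 i = 0].
Proof.
move=> AS; pose E : 'M[F]_(#|S|, n) := \matrix_(k, j) (enum_val k == j)%:R.
(* E selects the rows of A in S; it is row-free. *)
have EE : E *m E^T = 1%:M.
  apply/matrixP => k l; rewrite !mxE (bigD1 (enum_val k)) //= !mxE eqxx mul1r.
  rewrite big1 => [|j /negbTE jk]; last by rewrite !mxE eq_sym jk mul0r.
  by rewrite addr0 (inj_eq enum_val_inj) eq_sym.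
have /negbTE kerN0 : kermx (E *m A) != 0.
  rewrite kermx_eq0 /row_free neq_ltn (leq_ltn_trans _ AS) //.
  exact: mxrankM_maxr.
have [u uker un0] := @rowV0Pn _ _ _ (kermx (E *m A)) (negbT kerN0).
exists (u *m E); split.
- apply: contra_neq un0 => uE.
  by rewrite -[u]mulmx1 -EE mulmxA uE mul0mx.
- by rewrite -mulmxA; apply/sub_kermxP.
move=> i iS; rewrite mxE big1 // => k _; rewrite mxE.
case: eqP => [ki|]; last by rewrite mulr0.
by case/negP: iS; rewrite -ki enum_valP.
Qed.

(** Each of the T relations has a pivot on which the others vanish, so they
    are linearly independent. *)
Lemma rank_pivot_annihilator (F : fieldType) (n m T : nat)
    (B : 'M[F]_(n, m)) (L : 'M[F]_(T, n)) (pv : 'I_T -> 'I_n) :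
  L *m B = 0 -> (forall t t', (L t (pv t') != 0) = (t == t')) ->
  (\rank B <= n - T)%N.
Proof.
move=> LB Lpv; have := mulmx0_rank_max LB.
have -> : \rank L = T; last by move=> /(leq_sub2r T); rewrite addKn.
apply/eqP; rewrite eqn_leq rank_leq_row /=.
pose E : 'M[F]_(n, T) := \matrix_(i, t) (i == pv t)%:R.
pose D : 'rV[F]_T := \row_t L t (pv t).
have LE : L *m E = diag_mx D.
  apply/matrixP => t t'; rewrite !mxE (bigD1 (pv t')) //= big1 => [|i /negbTE ip].
    rewrite !mxE eqxx mulr1 addr0; have := Lpv t t'.
    by case: (eqVneq t t') => [-> //|_ /negbFE/eqP ->].
  by rewrite !mxE ip mulr0.
have Du : diag_mx D \in unitmx.
  rewrite unitmxE det_diag unitfE; apply/prodf_neq0 => t _.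
  by rewrite mxE Lpv.
by rewrite -{1}(mxrank_unit Du) -LE mxrankM_maxl.
Qed.

(** The groups [G t] are disjoint, but each relation also uses the common row
    [i0], on which all the phases are normalized to 1. *)
Lemma low_rank_sqrt_phases (R : rcfType) (n m T : nat) (A : 'M[R]_(n, m))
    (i0 : 'I_n) (G : 'I_T -> {set 'I_n}) :
  (forall i j, 0 <= A i j) -> row i0 A != 0 ->
  (forall t, i0 \notin G t) -> (forall t, \rank A <= #|G t|)%N ->
  (forall t t' i, i \in G t -> i \in G t' -> t = t') ->
  exists B : 'M[R[i]]_(n, m),
    (forall i j, `|B i j| = (Num.sqrt (A i j))%:C) /\ (\rank B <= n - T)%N.
Proof.
move=> A0 Ai0 i0G rkG disjG.
have /choice[c cP] : forall t, exists c : 'rV[R]_n, [/\ c != 0, c *m A = 0 &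
    forall i, i \notin i0 |: G t -> c 0 i = 0].
  by move=> t; apply: dependent_rows; rewrite cardsU1 i0G ltnS.
(* A relation supported on i0 alone would force row i0 of A to vanish. *)
have /choice[pv pvP] : forall t, exists i, i \in G t /\ c t 0 i != 0.
  move=> t; have [cn0 cA supp] := cP t.
  apply: contrapT => npv.
  have c0 i : i != i0 -> c t 0 i = 0.
    move=> ii0; case: (boolP (i \in G t)) => iG.
      by apply/eqP; apply: contrapT => /negP ci; apply: npv; exists i.
    by apply: supp; rewrite !inE negb_or ii0.
  have cE : c t = c t 0 i0 *: delta_mx 0 i0.
    apply/rowP => i; rewrite !mxE /=; case: eqVneq => [->|/c0 ->].
      by rewrite mulr1.
    by rewrite mulr0.
  move: cA; rewrite cE -scalemxAl -rowE => /eqP.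
  rewrite scaler_eq0 (negbTE Ai0) orbF => /eqP ci0.
  by move: cn0; rewrite cE ci0 scale0r eqxx.
have /choice[z zP] : forall tj : 'I_T * 'I_m, exists z : 'I_n -> R[i],
    [/\ forall i, `|z i| = (Num.sqrt (A i tj.2))%:C,
        z i0 = (Num.sqrt (A i0 tj.2))%:C &
        \sum_i (Num.sqrt `|c tj.1 0 i|)%:C * z i = 0].
  move=> [t j] /=; apply: (@sqrt_phases_dependent _ _ (c t 0) (A^~ j)) => //.
  by have [_ /matrixP/(_ 0 j)] := cP t; rewrite !mxE.
(* Rows outside all the groups, among them i0, keep the phase 1. *)
pose B := \matrix_(i, j) if [pick t | i \in G t] is Some t then z (t, j) i
                         else (Num.sqrt (A i j))%:C.
exists B; split.
  move=> i j; rewrite mxE; case: pickP => [t _|_].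
    by have [] := zP (t, j).
  by rewrite ger0_norm // ler0c sqrtr_ge0.
have BG t i j : i \in i0 |: G t -> B i j = z (t, j) i.
  rewrite in_setU1 mxE; case: eqVneq => [-> _|_ /= iG].
    case: pickP => [t' iG|_]; first by case/negP: (i0G t').
    by have [_ -> _] := zP (t, j).
  case: pickP => [t' iG'|/(_ t)]; last by rewrite iG.
  by rewrite (disjG _ _ _ iG' iG).
pose L : 'M[R[i]]_(T, n) := \matrix_(t, i) (Num.sqrt `|c t 0 i|)%:C.
have LN0 t i : (L t i != 0) = (c t 0 i != 0).
  by rewrite mxE (inj_eq (@complexI R)) sqrtr_eq0 normr_le0.
apply: (@rank_pivot_annihilator _ _ _ _ _ L pv).
  apply/matrixP => t j; rewrite !mxE.
  have [_ _ zt0] := zP (t, j); apply: etrans zt0; apply: eq_bigr => i _ /=.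
  rewrite mxE; case: (boolP (i \in i0 |: G t)) => [/BG -> //|iG].
  by have [_ _ ->//] := cP t; rewrite normr0 sqrtr0 !mul0r.
move=> t t'; rewrite LN0; have [pvG pv0] := pvP t'.
case: (eqVneq t t') => [->//|tt'].
have [_ _ supp] := cP t; rewrite supp ?eqxx // !inE negb_or.
apply/andP; split; first by apply: contraTneq pvG => ->.
by apply: contraNN tt' => pvG'; rewrite (disjG _ _ _ pvG' pvG).
Qed.

(** * From a complex square root to a psd factorization *)

Lemma adjmxM (C : numClosedFieldType) (m n l : nat) (X : 'M[C]_(m, n))
    (Y : 'M[C]_(n, l)) :
  (X *m Y) ^t* = Y ^t* *m X ^t*.
Proof. by rewrite trmx_mul map_mxM. Qed.

Lemma adjmxK (C : numClosedFieldType) (m n : nat) (X : 'M[C]_(m, n)) :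
  X ^t* ^t* = X.
Proof. by apply/matrixP => i j; rewrite !mxE conjCK. Qed.

Lemma gram_psd (R : realType) (k l : nat) (u : 'M[R[i]]_(l, k)) :
  psdmx (u ^t* *m u).
Proof.
split; first by apply/is_hermitianmxP; rewrite expr0 scale1r adjmxM adjmxK.
move=> x.
have -> : x *m (u ^t* *m u) *m x ^t* = (u *m x ^t*) ^t* *m (u *m x ^t*).
  by rewrite adjmxM adjmxK !mulmxA.
rewrite mxE; apply: sumr_ge0 => i _.
by rewrite 2![in X in X * _]mxE mulrC mul_conjC_ge0.
Qed.

(** For row vectors u and w, tr (u^* u w^* w) = |u w^*|^2; apply this to the
    vectors of a rank factorization of B. *)
Lemma psd_factorization_rank (R : realType) (n m : nat) (A : 'M[R]_(n, m))
    (B : 'M[R[i]]_(n, m)) :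
  (forall i j, `|B i j| ^+ 2 = (A i j)%:C) -> psd_factorization A (\rank B).
Proof.
move=> BA.
pose u i := row i (col_base B); pose w j := (col j (row_base B)) ^t*.
exists (fun i => (u i) ^t* *m u i); exists (fun j => (w j) ^t* *m w j).
split=> [i|j|i j]; [exact: gram_psd|exact: gram_psd|].
have uwB : (u i *m (w j) ^t*) 0 0 = B i j.
  rewrite adjmxK -[in RHS](mulmx_base B) !mxE.
  by apply: eq_bigr => l _; rewrite !mxE.
rewrite -mulmxA mxtrace_mulC (mulmxA (u i)) -(mulmxA (u i *m _)).
have -> : w j *m (u i) ^t* = (u i *m (w j) ^t*) ^t* by rewrite adjmxM adjmxK.
rewrite /mxtrace big_ord1 mxE big_ord1.
by rewrite 2![in X in _ * X]mxE uwB -normCK BA.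
Qed.

Lemma psd_factorization_tr (R : realType) (n m : nat) (A : 'M[R]_(n, m))
    (k : nat) :
  psd_factorization A^T k -> psd_factorization A k.
Proof.
move=> [U [V [U0 V0 UV]]]; exists V, U; split => // i j.
by rewrite mxtrace_mulC -UV mxE.
Qed.

(** * The bound for nonnegative matrices and for slack matrices *)

Lemma psd_factorization_le_rows (R : realType) (n m r : nat)
    (A : 'M[R]_(n, m)) :
  (forall i j, 0 <= A i j) -> (\rank A <= r)%N -> (0 < r)%N ->
  exists k, psd_factorization A k /\ (k <= n - (n - 1) %/ r)%N.
Proof.
move=> A0 rkA r0.
have [A00|An0] := eqVneq A 0.
  exists (\rank (0 : 'M[R[i]]_(n, m))); split; last by rewrite mxrank0.
  by apply: psd_factorization_rank => i j; rewrite A00 !mxE normr0 expr0n.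
have [i0 Ai0] : exists i0, row i0 A != 0.
  apply/existsP; apply: contraNT An0 => /existsPn rA.
  by apply/eqP/row_matrixP => i; rewrite row0; apply/eqP/negPn/rA.
case: n A A0 rkA An0 i0 Ai0 => [|n] A A0 rkA _ i0 Ai0; first by have := ltn_ord i0.
rewrite subn1 /=; set T := (n %/ r)%N.
(* Once i0 is removed, the group t is the t-th run of r consecutive rows. *)
pose G (t : 'I_T) := [set lift i0 s | s : 'I_n & (s %/ r == t)%N].
have [|||B [BA rkB]] := @low_rank_sqrt_phases R _ _ T A i0 G A0 Ai0.
- move=> t; apply/imsetP => -[s _ /eqP].
  by rewrite (negbTE (neq_lift _ _)).
- move=> t; rewrite (leq_trans rkA) // card_imset; last exact: lift_inj.
  have ltn (s : 'I_r) : (t * r + s < n)%N.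
    apply: leq_trans (leq_trunc_div n r); rewrite -/T.
    apply: (@leq_trans (t.+1 * r)%N); last by rewrite leq_mul2r ltn_ord orbT.
    by rewrite mulSn addnC ltn_add2r.
  pose g s := Ordinal (ltn s).
  rewrite -{1}(card_ord r) -(@card_imset _ _ g); last first.
    by move=> s s' /(congr1 val) /addnI/val_inj.
  apply/subset_leq_card/fintype.subsetP => _ /imsetP[s _ ->].
  by rewrite inE /= divnMDl // divn_small // addn0.
- move=> t t' _ /imsetP[s /[!inE]/eqP st ->] /imsetP[s' /[!inE]/eqP st'].
  by move=> /lift_inj ss'; apply: val_inj; rewrite /= -st -st' ss'.
exists (\rank B); split => //; apply: psd_factorization_rank => i j.
by rewrite BA -rmorphXn /= sqr_sqrtr.
Qed.

(** Slacks are the pairings of the vectors (p_i, 1) and (- a_j, b_j), of length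
    d + 1. *)
Lemma rank_slack_matrix (R : realType) (d v f : nat) (p : 'I_v -> 'rV[R]_d)
    (a : 'I_f -> 'rV[R]_d) (b : 'I_f -> R) :
  (\rank (slack_matrix p a b) <= d + 1)%N.
Proof.
pose X : 'M[R]_(v, d + 1) := row_mx (\matrix_i p i) (const_mx 1).
pose Y : 'M[R]_(d + 1, f) := col_mx (\matrix_(k, j) - a j 0 k) (\row_j b j).
have -> : slack_matrix p a b = X *m Y; last exact: mulmx_max_rank.
apply/matrixP => i j; rewrite mul_row_col !mxE big_ord1 !mxE mul1r addrC.
congr (_ + _); rewrite /inner -sumrN; apply: eq_bigr => k _.
by rewrite !mxE mulrN mulrC.
Qed.

Theorem corollary6p10 (R : realType) (d v f : nat) (P : set 'rV[R]_d)
  (p : 'I_v -> 'rV[R]_d) (a : 'I_f -> 'rV[R]_d) (b : 'I_f -> R)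
  (hP : polytope P) (hdim : has_dim P (Posz d))
  (hp : vertices_of P p) (hab : facets_of P a b) :
  (psd_rankC (slack_matrix p a b)
     <= minn v f - (minn v f - 1) %/ (d + 1))%N.
Proof.
have S0 := slack_matrix_ge0 hp hab.
have rkS := rank_slack_matrix p a b.
have d0 : (0 < d + 1)%N by rewrite addn1.
have [_ least] := psd_rankC_least S0.
case: (leqP v f) => [vf|fv].
  have [k [Sk /(leq_trans _)]] := psd_factorization_le_rows S0 rkS d0.
  by apply; apply: least.
have St0 i j : 0 <= (slack_matrix p a b)^T i j by rewrite mxE S0.
rewrite -mxrank_tr in rkS.
have [k [Sk /(leq_trans _)]] := psd_factorization_le_rows St0 rkS d0.
by apply; apply: least; apply: psd_factorization_tr.
Qed.
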